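(* Let $L>0$, $\mu\ge0$, and let $f:\mathbb{R}^n\to\mathbb{R}$ be $L$-smooth and $\mu$-strongly convex (merely convex if $\mu=0$) with a minimizer $x_*$. Let $K\ge0$ be an integer, $m\ge1$, and for $i=1,\dots,m$ let $\beta_i\in[0,1)$ and $$0<\gamma_i\le\frac{(1-\max_{1\le j\le m}\beta_j)(1-\beta_i)}{2\mu}$$ (the upper bound being void if $\mu=0$). Suppose that $$F=\frac1m\sum_{i=1}^m\frac{\gamma_i}{1-\beta_i}\le\frac1{4L},\qquad BF\le\frac{1-\max_{1\le i\le m}\beta_i}{48L^2},\qquad\text{where } B=\frac1m\sum_{i=1}^m\frac{\beta_i\gamma_i(1-\beta_i^{K+1})}{(1-\beta_i)^2}.$$ Let $(x_k)_{k\ge0}$ be generated by the Aggregated Heavy-Ball method (AggHB) with stepsizes $\gamma_i$ and momentum parameters $\beta_i$, started at $x_0\in\mathbb{R}^n$. Put $w_k=\left(1-\frac{\mu F}{2}\right)^{-(k+1)}$, $W_K=\sum_{k=0}^Kw_k$ and $\overline{x}_K=\frac1{W_K}\sum_{k=0}^Kw_kx_k$. Then $$f(\overline{x}_K)-f(x_* )\le\frac{4\|x_0-x_*\|_2^2}{FW_K}.$$ Consequently, $$f(\overline{x}_K)-f(x_* )\le\left(1-\frac{\mu F}{2}\right)^K\frac{4\|x_0-x_*\|_2^2}{F}\quad\text{if }\mu>0,$$ $$f(\overline{x}_K)-f(x_* )\le\frac{4\|x_0-x_*\|_2^2}{FK}\quad\text{if }\mu=0\ (\text{and }K\ge1).$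$
   Context: A differentiable function $f:\mathbb{R}^n\to\mathbb{R}$ is $L$-smooth if $\|\nabla f(x)-\nabla f(y)\|_2\le L\|x-y\|_2$ for all $x,y\in\mathbb{R}^n$, and $\mu$-strongly convex if $f(y)\ge f(x)+\langle\nabla f(x),y-x\rangle+\frac\mu2\|y-x\|_2^2$ for all $x,y\in\mathbb{R}^n$ (for $\mu=0$ this is convexity). Aggregated Heavy-Ball method (AggHB): given $x_0\in\mathbb{R}^n$, stepsizes $\gamma_i>0$ and momentum parameters $\beta_i$ ($i=1,\dots,m$), put $V_{-1}^{(i)}=0$ and, for $k=0,1,2,\dots$, $$V_k^{(i)}=\beta_iV_{k-1}^{(i)}+\nabla f(x_k)\quad(i=1,\dots,m),\qquad x_{k+1}=x_k-\frac1m\sum_{i=1}^m\gamma_iV_k^{(i)}.$$ *)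

(* Defs.v *)
From HB Require Import structures.
From mathcomp Require Import all_boot all_order all_algebra.
From mathcomp Require Import all_classical all_reals all_analysis.

Set Implicit Arguments.
Unset Strict Implicit.
Unset Printing Implicit Defensive.

Import Order.TTheory GRing.Theory Num.Theory.
Import numFieldNormedType.Exports.

Local Open Scope ring_scope.

Section Euclidean.
Context {R : realType} {n : nat}.

Definition dotp (u v : 'rV[R]_n) : R := \sum_(j < n) u 0 j * v 0 j.

                                                                            
                                                                                
Definition norm2 (u : 'rV[R]_n) : R := Num.sqrt (dotp u u).

Definition grad (f : 'rV[R]_n -> R) (x : 'rV[R]_n) : 'rV[R]_n :=
  \row_(j < n) 'D_(delta_mx 0 j) (f : 'rV[R]_n -> R^o) x.

Definition differentiable_everywhere (f : 'rV[R]_n -> R) : Prop :=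
  forall x, differentiable (f : 'rV[R]_n -> R^o) x.

Definition smooth (L : R) (f : 'rV[R]_n -> R) : Prop :=
  differentiable_everywhere f /\
  forall x y, norm2 (grad f x - grad f y) <= L * norm2 (x - y).

Definition strongly_convex (mu : R) (f : 'rV[R]_n -> R) : Prop :=
  differentiable_everywhere f /\
  forall x y,
    f x + dotp (grad f x) (y - x) + mu / 2 * norm2 (y - x) ^+ 2 <= f y.

Definition minimizer (f : 'rV[R]_n -> R) (xs : 'rV[R]_n) : Prop :=
  forall x, f xs <= f x.

End Euclidean.

Section AggHB.
Context {R : realType} {n m : nat}.
Variables (f : 'rV[R]_n -> R) (gamma beta : 'I_m -> R) (x0 : 'rV[R]_n).

                                                                              
                                                                   
Definition aggHB_step (s : 'rV[R]_n * ('I_m -> 'rV[R]_n)) :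
    'rV[R]_n * ('I_m -> 'rV[R]_n) :=
  let V i := beta i *: s.2 i + grad f s.1 in
  (s.1 - m%:R^-1 *: \sum_(i < m) gamma i *: V i, V).

Definition aggHB_state (k : nat) : 'rV[R]_n * ('I_m -> 'rV[R]_n) :=
  iter k aggHB_step (x0, fun=> 0).

Definition aggHB (k : nat) : 'rV[R]_n := (aggHB_state k).1.

End AggHB.

Section Stepsizes.
Context {R : realType} {m : nat}.
Variables (gamma beta : 'I_m -> R).

                                                           
Definition beta_max : R := \big[Num.max/0]_(i < m) beta i.

Definition aggF : R := m%:R^-1 * \sum_(i < m) gamma i / (1 - beta i).

Definition aggB (K : nat) : R :=
  m%:R^-1 * \sum_(i < m)
    beta i * gamma i * (1 - beta i ^+ K.+1) / (1 - beta i) ^+ 2.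

End Stepsizes.

Section Averaging.
Context {R : realType} {n : nat}.
Variables (mu F : R).

Definition weight (k : nat) : R := (1 - mu * F / 2) ^- k.+1.

Definition weight_sum (K : nat) : R := \sum_(k < K.+1) weight k.

Definition weighted_avg (x : nat -> 'rV[R]_n) (K : nat) : 'rV[R]_n :=
  (weight_sum K)^-1 *: \sum_(k < K.+1) weight k *: x k.

End Averaging.

(* Main.v *)
(* The shifted iterates [y k = x k - lag k], where [lag k] is the mean over [i] of
   [beta i * gamma i / (1 - beta i)] times the previous momentum, satisfy
   [y (k+1) = y k - F * grad f (x k)], that is, they perform gradient descent with
   a delayed gradient.  Expanding the squared distance of [y k] to the minimizer
   gives a contraction by [1 - mu * F / 2] and a gain of [F / 2] times the gap
   [f (x k) - f xs], up to an error [3 * L * F * |lag k|^2].  By Cauchy-Schwarz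
   [|lag k|^2] is at most [aggB] times a mean of discounted sums of past squared
   gradients, which are at most [2 * L] times the gaps; after weighting, the
   condition on [aggB * aggF] makes the error absorb at most a third of the gain.
   Telescoping and Jensen's inequality conclude. *)
Require Import Defs.
From HB Require Import structures.
From mathcomp Require Import all_boot all_order all_algebra.
From mathcomp Require Import all_classical all_reals all_analysis.
From mathcomp Require Import ring lra.

Set Implicit Arguments.
Unset Strict Implicit.
Unset Printing Implicit Defensive.

Import Order.TTheory GRing.Theory Num.Theory.
Import numFieldNormedType.Exports.

Local Open Scope ring_scope.

(** * Inner products and a weighted Cauchy-Schwarz inequality *)

Lemma dotpC (R : realType) (n : nat) (u v : 'rV[R]_n) : dotp u v = dotp v u.
Proof. by apply: eq_bigr => j _; rewrite mulrC. Qed.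

Lemma dotpDl (R : realType) (n : nat) (u v w : 'rV[R]_n) :
  dotp (u + v) w = dotp u w + dotp v w.
Proof. by rewrite /dotp -big_split; apply: eq_bigr => j _; rewrite mxE mulrDl. Qed.

Lemma dotpZl (R : realType) (n : nat) (a : R) (u w : 'rV[R]_n) :
  dotp (a *: u) w = a * dotp u w.
Proof. by rewrite /dotp mulr_sumr; apply: eq_bigr => j _; rewrite mxE mulrA. Qed.

Lemma dotpNl (R : realType) (n : nat) (u w : 'rV[R]_n) :
  dotp (- u) w = - dotp u w.
Proof. by rewrite -scaleN1r dotpZl mulN1r. Qed.

Lemma dotpDr (R : realType) (n : nat) (u v w : 'rV[R]_n) :
  dotp w (u + v) = dotp w u + dotp w v.
Proof. by rewrite dotpC dotpDl !(dotpC w). Qed.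

Lemma dotpZr (R : realType) (n : nat) (a : R) (u w : 'rV[R]_n) :
  dotp w (a *: u) = a * dotp w u.
Proof. by rewrite dotpC dotpZl (dotpC w). Qed.

Lemma dotpNr (R : realType) (n : nat) (u w : 'rV[R]_n) :
  dotp w (- u) = - dotp w u.
Proof. by rewrite dotpC dotpNl (dotpC w). Qed.

Lemma dotp0r (R : realType) (n : nat) (u : 'rV[R]_n) : dotp u 0 = 0.
Proof. by rewrite /dotp big1 // => j _; rewrite mxE mulr0. Qed.

Lemma dotp_sumr (R : realType) (n N : nat) (w : 'rV[R]_n) (u : 'I_N -> 'rV[R]_n) :
  dotp w (\sum_(k < N) u k) = \sum_(k < N) dotp w (u k).
Proof. by apply: (big_morph (dotp w)) => [x y|]; rewrite ?dotpDr ?dotp0r. Qed.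

Definition dotpE := (dotpDl, dotpDr, dotpZl, dotpZr, dotpNl, dotpNr).

Lemma dotp_ge0 (R : realType) (n : nat) (u : 'rV[R]_n) : 0 <= dotp u u.
Proof. by apply: sumr_ge0 => j _; rewrite -expr2 sqr_ge0. Qed.

Lemma norm2_sqr (R : realType) (n : nat) (u : 'rV[R]_n) :
  norm2 u ^+ 2 = dotp u u.
Proof. by rewrite sqr_sqrtr ?dotp_ge0. Qed.

Lemma dotp_young (R : realType) (n : nat) (a : R) (u v : 'rV[R]_n) :
  0 < a -> 2 * dotp u v <= a * dotp u u + a^-1 * dotp v v.
Proof.
move=> a0; have := dotp_ge0 (a *: u - v).
rewrite !dotpE (dotpC v) => h.
rewrite -(ler_pM2l a0) mulrDr (mulrA a a^-1) divff ?gt_eqF // mul1r.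
by nra.
Qed.

Lemma dotp_cauchy_schwarz (R : realType) (n : nat) (u v : 'rV[R]_n) :
  dotp u v ^+ 2 <= dotp u u * dotp v v.
Proof.
have [v0|vn0] := eqVneq (dotp v v) 0.
  rewrite v0 mulr0.
  suff -> : dotp u v = 0 by rewrite expr0n.
  have h j : v 0 j = 0.
    move/eqP: v0; rewrite /dotp psumr_eq0 => [|i _]; last by rewrite -expr2 sqr_ge0.
    by move/allP => /(_ j (mem_index_enum _)); rewrite -expr2 sqrf_eq0 => /eqP.
  by rewrite /dotp big1 // => j _; rewrite h mulr0.
have vgt0 : 0 < dotp v v by rewrite lt_neqAle eq_sym vn0 dotp_ge0.
have := dotp_ge0 (dotp v v *: u - dotp u v *: v).
rewrite !dotpE (dotpC v u) -(pmulr_rge0 _ vgt0) => h.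
rewrite -subr_ge0 -(pmulr_rge0 _ vgt0) -(pmulr_rge0 _ vgt0).
by apply: le_trans h _; rewrite le_eqVlt; apply/orP; left; apply/eqP; ring.
Qed.

(** Bounds in product form add up because Cauchy-Schwarz and AM-GM give
    [2 * dotp u v <= s * r + t * q]. Nothing is divided, so weights may vanish. *)
Lemma dotp_add_le (R : realType) (n : nat) (u v : 'rV[R]_n) (s q t r : R) :
  0 <= s -> 0 <= q -> 0 <= t -> 0 <= r ->
  dotp u u <= s * q -> dotp v v <= t * r ->
  dotp (u + v) (u + v) <= (s + t) * (q + r).
Proof.
move=> s0 q0 t0 r0 hu hv.
have h : dotp u v ^+ 2 <= (s * q) * (t * r).
  by apply: le_trans (dotp_cauchy_schwarz u v) _; apply: ler_pM; rewrite ?dotp_ge0.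
suff : 2 * dotp u v <= s * r + t * q by rewrite !dotpE (dotpC v u); nra.
have y0 : 0 <= s * r + t * q by rewrite addr_ge0 ?mulr_ge0.
(* If this failed, squaring would contradict [(s * r + t * q) ^+ 2 >= 4 * (s * q) * (t * r)]. *)
rewrite leNgt; apply/negP => lt.
have := sqr_ge0 (s * r - t * q).
have : (s * r + t * q) ^+ 2 < (2 * dotp u v) ^+ 2.
  by rewrite ltr_pXn2r // nnegrE ?(ltW (le_lt_trans y0 lt)).
by nra.
Qed.

Lemma dotp_sum_le (R : realType) (n m : nat) (u : 'I_m -> 'rV[R]_n) (s q : 'I_m -> R) :
  (forall i, 0 <= s i) -> (forall i, 0 <= q i) ->
  (forall i, dotp (u i) (u i) <= s i * q i) ->
  dotp (\sum_i u i) (\sum_i u i) <= (\sum_i s i) * (\sum_i q i).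
Proof.
move=> s0 q0 h.
suff [//] : [/\ dotp (\sum_i u i) (\sum_i u i) <= (\sum_i s i) * (\sum_i q i),
  0 <= \sum_i s i & 0 <= \sum_i q i].
elim/big_rec3 : _ => [|i x y z _ [hx hy hz]]; first by rewrite dotp0r mulr0.
by split; rewrite ?addr_ge0 //; apply: dotp_add_le.
Qed.

Lemma dotp_scale_le (R : realType) (n : nat) (a s q : R) (u : 'rV[R]_n) :
  dotp u u <= s * q -> dotp (a *: u) (a *: u) <= (a * s) * (a * q).
Proof.
move=> h; rewrite !dotpE mulrA (_ : a * s * (a * q) = a * a * (s * q)); last by ring.
by rewrite ler_wpM2l // -expr2 sqr_ge0.
Qed.

(** * Discounted sums *)

(** The sum of [b ^+ (k - 1 - j) * G j] over [j < k], in the recursive form of the momentum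
    update. *)
Fixpoint discounted (R : realType) (b : R) (G : nat -> R) (k : nat) : R :=
  if k is j.+1 then b * discounted b G j + G j else 0.

Lemma discounted_ge0 (R : realType) (b : R) (G : nat -> R) (k : nat) :
  0 <= b -> (forall j, 0 <= G j) -> 0 <= discounted b G k.
Proof. by move=> b0 G0; elim: k => //= k ih; rewrite addr_ge0 ?mulr_ge0. Qed.

Lemma discounted1 (R : realType) (b : R) (k : nat) :
  b < 1 -> discounted b (fun=> 1) k = (1 - b ^+ k) / (1 - b).
Proof.
move=> b1; have b2 : 1 - b != 0 by rewrite gt_eqF ?subr_gt0.
elim: k => [|k ih] /=; first by rewrite subrr mul0r.
by rewrite ih exprS; field.
Qed.

(** The identity [h] telescopes, which replaces exchanging a double sum and summing a geometric
    series. Its remainder [r ^- N * discounted b G N] is nonnegative and is dropped. *)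
Lemma discounted_weighted_sum (R : realType) (b r : R) (G : nat -> R) (N : nat) :
  0 <= b -> 0 < r -> (forall j, 0 <= G j) ->
  (r - b) * \sum_(k < N) r ^- k.+1 * discounted b G k
    <= \sum_(k < N) r ^- k.+1 * G k.
Proof.
move=> b0 r0 G0; have rn0 : r != 0 by rewrite gt_eqF.
suff h : (r - b) * (\sum_(k < N) r ^- k.+1 * discounted b G k)
    + r ^- N * discounted b G N = \sum_(k < N) r ^- k.+1 * G k.
  rewrite -h lerDl mulr_ge0 ?discounted_ge0 //.
  by rewrite invr_ge0 exprn_ge0 ?ltW.
elim: N => [|N ih]; first by rewrite !big_ord0 !mulr0 addr0.
rewrite !big_ord_recr /= -ih !exprS.
by field; rewrite expf_neq0.
Qed.

(** * Smooth convex functions *)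

Lemma le_of_le_div_nat (R : realType) (a c : R) :
  (forall N : nat, a <= c / N.+1%:R) -> a <= 0.
Proof.
move=> h; rewrite leNgt; apply/negP => a0.
have c0 : 0 <= c by have := h 0; rewrite divr1; apply/le_trans/ltW.
have := h (Num.bound (c / a)).
rewrite ler_pdivlMr ?ltr0Sn // leNgt => /negP; apply.
have : c / a < (Num.bound (c / a))%:R.
  by have := archi_boundP (divr_ge0 c0 (ltW a0)).
rewrite ltr_pdivrMr // mulrC => /lt_le_trans; apply.
by rewrite ler_pM2l // ler_nat.
Qed.

Section Smooth.
Context {R : realType} {n : nat}.

(** Young's inequality with weight [(L * t)^-1] makes both of its terms at most
    [L * t * dotp v v]. *)
Lemma smooth_dotp (L : R) (f : 'rV[R]_n -> R) (x y v : 'rV[R]_n) (t : R) :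
  0 < L -> smooth L f -> 0 < t -> y - x = t *: v ->
  dotp (grad f y - grad f x) v <= L * t * dotp v v.
Proof.
move=> L0 [_ hs] t0 e.
have lt0 : 0 < L * t by rewrite mulr_gt0.
have h : dotp (grad f y - grad f x) (grad f y - grad f x)
    <= (L * t) ^+ 2 * dotp v v.
  rewrite -norm2_sqr; apply: (@le_trans _ _ ((L * norm2 (y - x)) ^+ 2)).
    by rewrite lerXn2r ?nnegrE ?hs // ?(mulr_ge0 (ltW L0)) ?sqrtr_ge0.
  by rewrite exprMn norm2_sqr e !dotpE; lra.
have ilt0 : 0 < (L * t)^-1 by rewrite invr_gt0.
have := dotp_young (grad f y - grad f x) v ilt0.
move/le_trans => /(_ (L * t * dotp v v + L * t * dotp v v)).
suff le : (L * t)^-1 * dotp (grad f y - grad f x) (grad f y - grad f x)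
    <= L * t * dotp v v by rewrite invrK lerD2r => /(_ le); lra.
by rewrite ler_pdivrMl // mulrA -expr2.
Qed.

Lemma convex_le (mu : R) (f : 'rV[R]_n -> R) (x y : 'rV[R]_n) :
  0 <= mu -> strongly_convex mu f -> f x + dotp (grad f x) (y - x) <= f y.
Proof.
move=> mu0 [_ h]; apply: le_trans (h x y); rewrite lerDl.
by rewrite mulr_ge0 ?sqr_ge0 ?divr_ge0.
Qed.

(* For a convex function the descent lemma needs no integration: bound each of
   [N] equal increments on the segment by the gradient at its far end, which
   gives the constant [L / 2 * (1 + 1 / N)], and let [N] tend to infinity. *)
Lemma descent (L mu : R) (f : 'rV[R]_n -> R) (x v : 'rV[R]_n) :
  0 < L -> 0 <= mu -> smooth L f -> strongly_convex mu f ->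
  f (x + v) <= f x + dotp (grad f x) v + L / 2 * dotp v v.
Proof.
move=> L0 mu0 hs hc.
suff h N : f (x + v) - (f x + dotp (grad f x) v + L / 2 * dotp v v)
    <= (L / 2 * dotp v v) / N.+1%:R.
  by rewrite -subr_le0; apply: le_of_le_div_nat h.
set c : R := N.+1%:R.
have c0 : 0 < c by rewrite ltr0Sn.
(* The last term collects the errors [c^-1 * L * (i / c) * dotp v v] of the increments
   [i = 1, ..., j]. *)
suff h j : f (x + (j%:R / c) *: v) <= f x + j%:R / c * dotp (grad f x) v
    + L / 2 * dotp v v * (j%:R * (j%:R + 1) / c ^+ 2).
  have := h N.+1; rewrite -/c divff ?gt_eqF // scale1r mul1r.
  rewrite (_ : c * (c + 1) / c ^+ 2 = 1 + c^-1); last by field; rewrite gt_eqF.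
  by rewrite mulrDr mulr1 addrA -lerBlDl.
elim: j => [|j ih]; first by rewrite !mul0r scale0r !addr0 mulr0 addr0.
set y := x + (j.+1%:R / c) *: v.
have t0 : 0 < j.+1%:R / c :> R by rewrite divr_gt0 ?ltr0Sn.
have e1 : y - x = (j.+1%:R / c) *: v by rewrite /y addrC addKr.
have e2 : x + (j%:R / c) *: v - y = - (c^-1 *: v).
  rewrite /y -scaleNr opprD addrACA subrr add0r -scalerBl -natr1.
  by congr (_ *: _); field; rewrite gt_eqF.
have h1 := smooth_dotp L0 hs t0 e1.
have := convex_le y (x + (j%:R / c) *: v) mu0 hc.
rewrite e2 !dotpE => h2.
have h3 : c^-1 * dotp (grad f y) v
    <= c^-1 * (dotp (grad f x) v + L * (j.+1%:R / c) * dotp v v).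
  by rewrite ler_pM2l ?invr_gt0 //; move: h1; rewrite !dotpE -lerBlDl.
have h4 : f y <= f (x + (j%:R / c) *: v)
    + c^-1 * (dotp (grad f x) v + L * (j.+1%:R / c) * dotp v v).
  by move: h2; rewrite lerBlDr => /le_trans; apply; rewrite lerD2l.
apply: (le_trans h4); apply: (le_trans (lerD ih (lexx _))).
rewrite le_eqVlt; apply/orP; left; apply/eqP; rewrite -natr1.
by field; rewrite gt_eqF.
Qed.

(** A gradient step with stepsize [L^-1] cannot go below [f xs], while [descent] guarantees a
    decrease by the squared gradient over [2 * L]. *)
Lemma grad_sqr_le (L mu : R) (f : 'rV[R]_n -> R) (x xs : 'rV[R]_n) :
  0 < L -> 0 <= mu -> smooth L f -> strongly_convex mu f -> minimizer f xs ->
  dotp (grad f x) (grad f x) <= 2 * L * (f x - f xs).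
Proof.
move=> L0 mu0 hs hc hmin.
have := le_trans (hmin _) (descent x (- L^-1 *: grad f x) L0 mu0 hs hc).
rewrite !dotpE; set G := dotp _ _ => h.
have : L * f xs <= L * (f x + - L^-1 * G + L / 2 * (- L^-1 * (- L^-1 * G))).
  by rewrite ler_pM2l.
rewrite (_ : L * (_ + _ + _) = L * f x - G / 2); first lra.
by field; rewrite gt_eqF.
Qed.

(** Strong convexity between [v] and [0], added in both directions, bounds the gradient difference
    from below. The factor [dotp v v] stays because [mu <= L] can fail when [n = 0]. *)
Lemma strong_convexity_le_smoothness (L mu : R) (f : 'rV[R]_n -> R) (v : 'rV[R]_n) :
  0 < L -> smooth L f -> strongly_convex mu f ->
  mu * dotp v v <= L * dotp v v.
Proof.
move=> L0 hs [_ hc].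
have e : v - 0 = 1 *: v by rewrite subr0 scale1r.
have := smooth_dotp L0 hs ltr01 e.
have := hc 0 v; have := hc v 0.
by rewrite !norm2_sqr !(subr0, sub0r) !dotpE; lra.
Qed.

End Smooth.

(** * Shifted iterates and the size of the lag *)

Section AggregatedHeavyBall.
Context {R : realType} {n m : nat}.
Context (f : 'rV[R]_n -> R) (gamma beta : 'I_m -> R) (x0 : 'rV[R]_n).
Context (hm : (1 <= m)%N).
Context (hbeta : forall i, 0 <= beta i < 1).
Context (hgamma : forall i, 0 < gamma i).

Local Notation F := (aggF gamma beta).
Local Notation bmax := (beta_max beta).
Local Notation x := (aggHB f gamma beta x0).
Local Notation g k := (grad f (x k)).

Let coef i := beta i * gamma i / (1 - beta i).

(** The index is shifted by one: this is $V_{k-1}^{(i)}$, zero at [k = 0]. *)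
Definition momentum (k : nat) (i : 'I_m) : 'rV[R]_n :=
  (aggHB_state f gamma beta x0 k).2 i.

Definition lag (k : nat) : 'rV[R]_n :=
  \sum_(i < m) (m%:R^-1 * (beta i * gamma i / (1 - beta i))) *: momentum k i.

Lemma m_inv_gt0 : 0 < m%:R^-1 :> R.
Proof. by rewrite invr_gt0 ltr0n. Qed.

Lemma one_sub_beta_gt0 i : 0 < 1 - beta i.
Proof. by rewrite subr_gt0; have /andP[] := hbeta i. Qed.

Lemma coef_ge0 i : 0 <= coef i.
Proof.
have /andP[b0 _] := hbeta i.
by rewrite /coef divr_ge0 ?mulr_ge0 // ltW ?one_sub_beta_gt0.
Qed.

Lemma momentumS k i : momentum k.+1 i = beta i *: momentum k i + g k.
Proof. by []. Qed.

Lemma aggHBS k :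
  x k.+1 = x k - m%:R^-1 *: \sum_(i < m) gamma i *: momentum k.+1 i.
Proof. by []. Qed.

Lemma lag0 : lag 0 = 0.
Proof. by rewrite /lag big1 // => i _; rewrite scaler0. Qed.

(** Since [gamma i + beta i * gamma i / (1 - beta i) = gamma i / (1 - beta i)], the gradient part of
    the new momentum gets the total coefficient [F] and its old part reproduces [lag k]. *)
Lemma shifted_step k : x k.+1 - lag k.+1 = (x k - lag k) - F *: g k.
Proof.
rewrite aggHBS -!addrA; congr (_ + _); rewrite -!opprD; congr (- _).
rewrite /lag /aggF mulr_sumr scaler_suml scaler_sumr -!big_split /=.
apply: eq_bigr => i _; rewrite momentumS !scalerDr !scalerA addrACA -!scalerDl.
have h : 1 - beta i != 0 by rewrite gt_eqF ?one_sub_beta_gt0.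
have mn : m%:R != 0 :> R by rewrite pnatr_eq0 -lt0n.
by congr (_ *: _ + _ *: _); field; rewrite ?h ?mn.
Qed.

(** Cauchy-Schwarz with the discount factors as weights, carried along the recursion. *)
Lemma momentum_le k i :
  dotp (momentum k i) (momentum k i)
  <= discounted (beta i) (fun=> 1) k
     * discounted (beta i) (fun k => dotp (g k) (g k)) k.
Proof.
have /andP[b0 b1] := hbeta i.
elim: k => [|k ih]; first by rewrite dotp0r mul0r.
rewrite momentumS; apply: dotp_add_le; rewrite ?mul1r ?dotp_ge0 //.
- by rewrite mulr_ge0 ?discounted_ge0.
- by rewrite mulr_ge0 ?discounted_ge0 // => j; apply: dotp_ge0.
- exact: dotp_scale_le.
Qed.

(** Cauchy-Schwarz over [i] on top of [momentum_le]. The first factor is the mean of [coef i * (1 -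
    beta i ^+ k) / (1 - beta i)], which is nondecreasing in [k] and equals [aggB gamma beta K] at
    [k = K.+1]. *)
Lemma lag_le K k : (k <= K.+1)%N ->
  dotp (lag k) (lag k) <= aggB gamma beta K *
    (m%:R^-1 * \sum_(i < m) beta i * gamma i / (1 - beta i)
      * discounted (beta i) (fun k => dotp (g k) (g k)) k).
Proof.
move=> kK; rewrite mulr_sumr.
have c0 i : 0 <= m%:R^-1 * coef i by rewrite mulr_ge0 ?coef_ge0 ?ltW ?m_inv_gt0.
have q0 i : 0 <= discounted (beta i) (fun k => dotp (g k) (g k)) k.
  have /andP[b0 _] := hbeta i.
  by apply: discounted_ge0 => // j; apply: dotp_ge0.
have s0 i : 0 <= discounted (beta i) (fun=> 1 : R) k.
  by have /andP[b0 _] := hbeta i; apply: discounted_ge0.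
have h : dotp (lag k) (lag k) <=
    (\sum_i m%:R^-1 * coef i * discounted (beta i) (fun=> 1) k)
    * (\sum_i m%:R^-1 * coef i * discounted (beta i) (fun k => dotp (g k) (g k)) k).
  apply: dotp_sum_le => i; rewrite ?(mulr_ge0 (c0 i)) //.
  by apply: dotp_scale_le; apply: momentum_le.
apply: (le_trans h).
under [X in _ <= _ * X]eq_bigr => i _ do rewrite mulrA.
apply: ler_wpM2r; first by apply: sumr_ge0 => i _; rewrite mulr_ge0.
rewrite /aggB mulr_sumr; apply: ler_sum => i _.
have /andP[b0 b1] := hbeta i.
rewrite discounted1 // -mulrA ler_pM2l ?m_inv_gt0 //.
have -> : beta i * gamma i * (1 - beta i ^+ K.+1) / (1 - beta i) ^+ 2
    = coef i * ((1 - beta i ^+ K.+1) / (1 - beta i)).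
  by rewrite /coef; field; rewrite gt_eqF ?one_sub_beta_gt0.
rewrite ler_wpM2l ?coef_ge0 // ler_pM2r ?invr_gt0 ?one_sub_beta_gt0 //.
by rewrite lerD2l lerN2 ler_wiXn2l // ltW.
Qed.

Lemma aggF_gt0 : 0 < F.
Proof.
rewrite mulr_gt0 ?m_inv_gt0 // (bigD1 (Ordinal hm)) //= ltr_wpDr //.
  by apply: sumr_ge0 => i _; rewrite divr_ge0 ?ltW ?one_sub_beta_gt0.
by rewrite divr_gt0 ?one_sub_beta_gt0.
Qed.

Lemma aggB_ge0 K : 0 <= aggB gamma beta K.
Proof.
apply: mulr_ge0; first exact: ltW m_inv_gt0.
apply: sumr_ge0 => i _.
have /andP[b0 b1] := hbeta i.
by rewrite divr_ge0 ?sqr_ge0 // !mulr_ge0 // ?subr_ge0 ?exprn_ile1 // ltW.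
Qed.

Lemma beta_max_lt1 : bmax < 1.
Proof. by apply: bigmax_lt => // i _; have /andP[] := hbeta i. Qed.

Lemma beta_le_max i : beta i <= bmax.
Proof. exact: (le_bigmax_cond _ beta). Qed.

Lemma beta_max_ge0 : 0 <= bmax.
Proof.
have /andP[b0 _] := hbeta (Ordinal hm).
exact: le_trans b0 (beta_le_max _).
Qed.

Lemma coef_mean_le : m%:R^-1 * \sum_(i < m) coef i <= F.
Proof.
rewrite ler_pM2l ?m_inv_gt0 //; apply: ler_sum => i _.
have /andP[b0 b1] := hbeta i.
rewrite /coef ler_pM2r ?invr_gt0 ?one_sub_beta_gt0 //.
by rewrite ler_piMl // ltW.
Qed.

Lemma mu_aggF_le (mu : R) : 0 <= mu ->
  (0 < mu -> forall i, gamma i <= (1 - bmax) * (1 - beta i) / (2 * mu)) ->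
  mu * F <= (1 - bmax) / 2.
Proof.
move=> mu0 h; have [->|mun0] := eqVneq mu 0.
  by rewrite mul0r divr_ge0 // subr_ge0 ltW ?beta_max_lt1.
have {}mu0 : 0 < mu by rewrite lt_neqAle eq_sym mun0.
have hF : \sum_(i < m) gamma i / (1 - beta i) <= m%:R * ((1 - bmax) / (2 * mu)).
  rewrite mulr_natl -[X in _ *+ X]card_ord -sumr_const; apply: ler_sum => i _.
  by rewrite ler_pdivrMr ?one_sub_beta_gt0 // mulrAC h.
have : mu * F <= mu * ((1 - bmax) / (2 * mu)).
  by rewrite ler_pM2l // /aggF ler_pdivrMl ?ltr0n.
by congr (_ <= _); field.
Qed.

(** * The one-step inequality and its weighted sum *)

Lemma one_step (L mu : R) (xs : 'rV[R]_n) k :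
  0 < L -> 0 <= mu -> smooth L f -> strongly_convex mu f -> minimizer f xs ->
  F <= 1 / (4 * L) ->
  norm2 (x k.+1 - lag k.+1 - xs) ^+ 2
  <= (1 - mu * F / 2) * norm2 (x k - lag k - xs) ^+ 2
     - F / 2 * (f (x k) - f xs) + 3 * L * F * dotp (lag k) (lag k).
Proof.
move=> L0 mu0 hs hc hmin hF.
have hgrad := grad_sqr_le (x k) L0 mu0 hs hc hmin.
have hmuL := strong_convexity_le_smoothness (lag k) L0 hs hc.
have F0 := aggF_gt0.
have := hc.2 (x k) xs.
rewrite !norm2_sqr shifted_step.
rewrite (_ : _ - _ - xs = x k - lag k - xs - F *: g k); last by rewrite addrAC.
rewrite (_ : xs - x k = - (x k - lag k - xs + lag k)); last first.
  by rewrite addrAC subrK opprB.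
move: (lag k) (x k - lag k - xs) hmuL => l e hmuL.
(* The weight 1/2 gives [|e + l|^2 >= |e|^2 / 2 - |l|^2], so half of [mu] survives in the
   contraction factor. *)
have half : (0 : R) < 2^-1 by rewrite invr_gt0.
have := dotp_young (- e) l half.
(* With weight [2 * L] the gradient term is [(2 * L)^-1 * G], which costs one of the two gaps [h]
   that strong convexity supplies. *)
have L2 : 0 < 2 * L by rewrite mulr_gt0.
have := dotp_young l (g k) L2.
rewrite !dotpE invrK (dotpC l e) (dotpC (g k) e) (dotpC (g k) l).
move: hgrad hmuL.
set h := f (x k) - f xs; set G := dotp (g k) (g k); set ll := dotp l l.
set ee := dotp e e; set el := dotp e l; set eg := dotp e (g k).
set lg := dotp l (g k) => hgrad hmuL h1 h2 h3.
have FL : F * (4 * L) <= 1 by rewrite -ler_pdivlMr ?mulr_gt0.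
have h0 : 0 <= h by rewrite subr_ge0.
have h4 : (2 * L)^-1 * G <= h by rewrite ler_pdivrMl ?mulr_gt0.
have h5 : - 2 * eg <= - 2 * h + 2 * lg - mu / 2 * ee + mu * ll.
  have : mu * (2 * - el) <= mu * (2^-1 * ee + 2 * ll) by rewrite ler_wpM2l //; lra.
  by rewrite /h in h3 *; lra.
(* The constant 3 is 2 from Young's inequality plus 1 from [mu * ll <= L * ll]. *)
have h6 : - 2 * eg <= - h - mu / 2 * ee + 3 * L * ll by lra.
have h7 : F * (- 2 * eg) <= F * (- h - mu / 2 * ee + 3 * L * ll) by rewrite ler_pM2l.
(* By [4 * L * F <= 1] the second-order term costs half of the remaining gap. *)
have h8 : F * (F * G) <= F * (h / 2).
  rewrite ler_pM2l //.
  have : F * G <= F * (2 * L * h) by rewrite ler_pM2l.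
  have : F * (4 * L) * h <= 1 * h by rewrite ler_wpM2r.
  by lra.
by lra.
Qed.

(** In this form the factor visibly exceeds every [beta i] by at least [3 / 4 * (1 - bmax)], the
    margin used with [discounted_weighted_sum]. *)
Lemma contraction_ge (mu : R) : 0 <= mu ->
  (0 < mu -> forall i, gamma i <= (1 - bmax) * (1 - beta i) / (2 * mu)) ->
  bmax + 3 / 4 * (1 - bmax) <= 1 - mu * F / 2.
Proof. by move=> mu0 /(mu_aggF_le mu0); lra. Qed.

(** Multiplying step [k] by [weight mu F k] makes the squared distances telescope, starting from
    [x0] because [lag 0 = 0]. *)
Lemma telescoped_steps (L mu : R) (xs : 'rV[R]_n) N :
  0 < L -> 0 <= mu -> smooth L f -> strongly_convex mu f -> minimizer f xs ->
  F <= 1 / (4 * L) -> 0 < 1 - mu * F / 2 ->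
  F / 2 * \sum_(k < N) weight mu F k * (f (x k) - f xs)
  <= norm2 (x0 - xs) ^+ 2
     + 3 * L * F * \sum_(k < N) weight mu F k * dotp (lag k) (lag k).
Proof.
move=> L0 mu0 hs hc hmin hF r0.
set r := 1 - mu * F / 2 in r0.
(* The final distance is carried through the induction and then discarded as nonnegative. *)
suff h : r ^- N * norm2 (x N - lag N - xs) ^+ 2
    + F / 2 * (\sum_(k < N) weight mu F k * (f (x k) - f xs))
    <= norm2 (x0 - xs) ^+ 2
     + 3 * L * F * \sum_(k < N) weight mu F k * dotp (lag k) (lag k).
  apply: le_trans h; rewrite lerDr mulr_ge0 ?sqr_ge0 //.
  by rewrite invr_ge0 exprn_ge0 // ltW.
elim: N => [|N ih].
  by rewrite !big_ord0 !mulr0 !addr0 lag0 subr0 expr0 invr1 mul1r.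
rewrite !big_ord_recr /= !mulrDr.
have w0 : 0 < r ^- N.+1 by rewrite invr_gt0 exprn_gt0.
have := one_step N L0 mu0 hs hc hmin hF; rewrite -/r -(ler_pM2l w0).
have wr : r ^- N.+1 * r = r ^- N.
  by rewrite exprS invfM mulrAC mulVf ?mul1r // gt_eqF.
move: ih; rewrite /weight -/r -wr.
set D := norm2 (x N - _ - _) ^+ 2; set D' := norm2 (x N.+1 - _ - _) ^+ 2.
by move: (r ^- N.+1) => w; lra.
Qed.

(** Multiplied by [F / 6], this bounds the lag error of [telescoped_steps] by a third of the gain
    there. *)
Lemma lag_sum_le (L mu : R) (xs : 'rV[R]_n) K :
  0 < L -> 0 <= mu -> smooth L f -> strongly_convex mu f -> minimizer f xs ->
  (0 < mu -> forall i, gamma i <= (1 - bmax) * (1 - beta i) / (2 * mu)) ->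
  aggB gamma beta K * F <= (1 - bmax) / (48 * L ^+ 2) ->
  18 * L * (\sum_(k < K.+1) weight mu F k * dotp (lag k) (lag k))
  <= \sum_(k < K.+1) weight mu F k * (f (x k) - f xs).
Proof.
move=> L0 mu0 hs hc hmin hg hBF.
have hr := contraction_ge mu0 hg.
set r := 1 - mu * F / 2 in hr.
have b1 : 0 < 1 - bmax by rewrite subr_gt0 beta_max_lt1.
have bm0 := beta_max_ge0.
have r0 : 0 < r by lra.
have w0 k : 0 <= weight mu F k by rewrite /weight invr_ge0 exprn_ge0 ?ltW.
pose G k := dotp (g k) (g k).
pose S := \sum_(k < K.+1) weight mu F k * G k.
pose Q i := \sum_(k < K.+1) weight mu F k * discounted (beta i) G k.
have G0 k : 0 <= G k by apply: dotp_ge0.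
have S0 : 0 <= S by apply: sumr_ge0 => k _; rewrite mulr_ge0.
have SG : S <= 2 * L * \sum_(k < K.+1) weight mu F k * (f (x k) - f xs).
  rewrite mulr_sumr; apply: ler_sum => k _; rewrite mulrCA ler_wpM2l //.
  exact: grad_sqr_le L0 mu0 hs hc hmin.
have hQ i : Q i <= 4 / (3 * (1 - bmax)) * S.
  have /andP[b0 _] := hbeta i.
  have Q0 : 0 <= Q i.
    by apply: sumr_ge0 => k _; rewrite mulr_ge0 ?discounted_ge0.
  have hS : (r - beta i) * Q i <= S by apply: discounted_weighted_sum.
  have : 3 / 4 * (1 - bmax) * Q i <= S.
    apply: le_trans hS; rewrite ler_wpM2r //.
    by have := beta_le_max i; lra.
  rewrite -ler_pdivlMl ?mulr_gt0 ?invr_gt0 //.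
  by congr (_ <= _ * _); field; rewrite gt_eqF.
(* [lag_le] is summed termwise, and exchanging the sums over [k] and [i] brings out the [Q i]. *)
have hlag : \sum_(k < K.+1) weight mu F k * dotp (lag k) (lag k)
    <= aggB gamma beta K * (m%:R^-1 * \sum_(i < m) coef i * Q i).
  have -> : aggB gamma beta K * (m%:R^-1 * \sum_(i < m) coef i * Q i)
      = \sum_(k < K.+1) weight mu F k * (aggB gamma beta K *
          (m%:R^-1 * \sum_(i < m) coef i * discounted (beta i) G k)).
    under [RHS]eq_bigr => k _ do rewrite mulrCA (mulrCA _ m%:R^-1) mulr_sumr.
    rewrite -!mulr_sumr exchange_big; congr (_ * (_ * _)).
    apply: eq_bigr => i _; rewrite mulr_sumr.
    by apply: eq_bigr => k _; rewrite mulrCA.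
  apply: ler_sum => k _; rewrite ler_wpM2l //; apply: lag_le.
  exact/ltnW/ltn_ord.
have hcoef : m%:R^-1 * \sum_(i < m) coef i * Q i
    <= F * (4 / (3 * (1 - bmax)) * S).
  apply: (@le_trans _ _ (m%:R^-1 * (\sum_(i < m) coef i)
      * (4 / (3 * (1 - bmax)) * S))); last first.
    by rewrite ler_wpM2r ?coef_mean_le // !mulr_ge0 // invr_ge0 mulr_ge0 // ltW.
  rewrite -mulrA ler_pM2l ?m_inv_gt0 // mulr_suml; apply: ler_sum => i _.
  by rewrite ler_wpM2l ?coef_ge0.
have h1 : \sum_(k < K.+1) weight mu F k * dotp (lag k) (lag k)
    <= aggB gamma beta K * F * (4 / (3 * (1 - bmax)) * S).
  by rewrite -mulrA; apply: (le_trans hlag); rewrite ler_wpM2l ?aggB_ge0.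
have h2 : aggB gamma beta K * F * (4 / (3 * (1 - bmax)) * S)
    <= (1 - bmax) / (48 * L ^+ 2) * (4 / (3 * (1 - bmax)) * S).
  by rewrite ler_wpM2r // !mulr_ge0 // invr_ge0 mulr_ge0 // ltW.
(* Here [48 * 3 / 4 = 36] and [18 / 36 = 1 / 2]; the resulting [(2 * L)^-1] cancels the factor in
   [SG]. *)
have h3 : 18 * L * ((1 - bmax) / (48 * L ^+ 2) * (4 / (3 * (1 - bmax)) * S))
    = (2 * L)^-1 * S by field; rewrite !gt_eqF.
apply: (@le_trans _ _ ((2 * L)^-1 * S)); last first.
  by rewrite ler_pdivrMl // mulr_gt0.
by rewrite -h3 ler_pM2l ?mulr_gt0 //; apply: le_trans h2.
Qed.

Lemma weighted_gap_le (L mu : R) (xs : 'rV[R]_n) K :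
  0 < L -> 0 <= mu -> smooth L f -> strongly_convex mu f -> minimizer f xs ->
  (0 < mu -> forall i, gamma i <= (1 - bmax) * (1 - beta i) / (2 * mu)) ->
  F <= 1 / (4 * L) ->
  aggB gamma beta K * F <= (1 - bmax) / (48 * L ^+ 2) ->
  \sum_(k < K.+1) weight mu F k * (f (x k) - f xs)
  <= 4 * norm2 (x0 - xs) ^+ 2 / F.
Proof.
move=> L0 mu0 hs hc hmin hg hF hBF.
have b1 := beta_max_lt1.
have bm0 := beta_max_ge0.
have r0 : 0 < 1 - mu * F / 2 by have := contraction_ge mu0 hg; lra.
have h1 := telescoped_steps K.+1 L0 mu0 hs hc hmin hF r0.
have h2 := lag_sum_le L0 mu0 hs hc hmin hg hBF.
have F0 := aggF_gt0.
(* Absorbing the lag error leaves [F / 3] times the sum, hence the constant 3; nonnegativity of the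
   squared distance relaxes it to 4. *)
have := ler_wpM2l (ltW F0) h2.
have := sqr_ge0 (norm2 (x0 - xs)).
by rewrite ler_pdivlMr //; lra.
Qed.

End AggregatedHeavyBall.

(** * Jensen's inequality and the rates *)

Lemma jensen (R : realType) (n : nat) (mu : R) (f : 'rV[R]_n -> R) (N : nat)
    (w : 'I_N -> R) (x : 'I_N -> 'rV[R]_n) :
  0 <= mu -> strongly_convex mu f ->
  (forall k, 0 <= w k) -> 0 < \sum_k w k ->
  f ((\sum_k w k)^-1 *: \sum_k w k *: x k) * (\sum_k w k)
  <= \sum_k w k * f (x k).
Proof.
move=> mu0 hc w0 W0; set W := \sum_k w k in W0 *.
set y := W^-1 *: _.
(* Tangent at the average [y]: the linear terms cancel because the weighted sum of [x k - y]
   vanishes. *)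
have -> : f y * W = \sum_k w k * (f y + dotp (grad f y) (x k - y)).
  under eq_bigr => k _ do rewrite mulrDr -dotpZr scalerBr.
  rewrite big_split /= -mulr_suml -dotp_sumr sumrB -scaler_suml -/W.
  by rewrite scalerA divff ?gt_eqF // scale1r subrr dotp0r addr0 mulrC.
by apply: ler_sum => k _; rewrite ler_wpM2l // (convex_le _ _ mu0 hc).
Qed.

Theorem theorem2p5 (R : realType) (n : nat) (L mu : R) (f : 'rV[R]_n -> R)
    (xs x0 : 'rV[R]_n) (K m : nat) (gamma beta : 'I_m -> R)
    (hL : 0 < L) (hmu : 0 <= mu)
    (hsmooth : smooth L f) (hconv : strongly_convex mu f)
    (hmin : minimizer f xs)
    (hm : (1 <= m)%N)
    (hbeta : forall i, 0 <= beta i < 1)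
    (hgamma : forall i, 0 < gamma i)
    (hgamma_mu : 0 < mu -> forall i,
       gamma i <= (1 - beta_max beta) * (1 - beta i) / (2 * mu))
    (hF : aggF gamma beta <= 1 / (4 * L))
    (hBF : aggB gamma beta K * aggF gamma beta
           <= (1 - beta_max beta) / (48 * L ^+ 2)) :
  let F := aggF gamma beta in
  let x := aggHB f gamma beta x0 in
  let WK := weight_sum mu F K in
  let xbar := weighted_avg mu F x K in
  [/\ f xbar - f xs <= 4 * norm2 (x0 - xs) ^+ 2 / (F * WK),
      0 < mu ->
        f xbar - f xs
        <= (1 - mu * F / 2) ^+ K * (4 * norm2 (x0 - xs) ^+ 2 / F)
    & mu = 0 -> (1 <= K)%N ->
        f xbar - f xs <= 4 * norm2 (x0 - xs) ^+ 2 / (F * K%:R)].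
Proof.
move=> F x WK xbar.
have F0 : 0 < F by apply: aggF_gt0.
have b1 : beta_max beta < 1 by apply: beta_max_lt1.
have bm0 : 0 <= beta_max beta by apply: beta_max_ge0.
have hr : beta_max beta + 3 / 4 * (1 - beta_max beta) <= 1 - mu * F / 2.
  exact: contraction_ge.
have r0 : 0 < 1 - mu * F / 2 by lra.
have r1 : 1 - mu * F / 2 <= 1.
  by rewrite gerBl divr_ge0 // mulr_ge0 // ltW.
have w0 k : 0 < weight mu F k by rewrite invr_gt0 exprn_gt0.
(* The last weight, with exponent [K.+1], already suffices because its base is at most 1. *)
have WK_ge : (1 - mu * F / 2) ^- K <= WK.
  rewrite /WK /weight_sum big_ord_recr /= ler_wpDl //.
    by apply: sumr_ge0 => k _; apply/ltW.
  by rewrite /weight lef_pV2 ?posrE ?exprn_gt0 // exprS ger_pMl ?exprn_gt0 //.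
have WK0 : 0 < WK by apply: lt_le_trans WK_ge; rewrite invr_gt0 exprn_gt0.
have main : f xbar - f xs <= 4 * norm2 (x0 - xs) ^+ 2 / (F * WK).
  rewrite invfM mulrA ler_pdivlMr // mulrBl.
  have := weighted_gap_le x0 hm hbeta hgamma hL hmu hsmooth hconv hmin
            hgamma_mu hF hBF.
  under eq_bigr => k _ do rewrite mulrBr.
  rewrite sumrB -mulr_suml (mulrC _ (f xs)); apply: le_trans.
  rewrite lerD2r; apply: (jensen x hmu hconv) => // k; exact/ltW.
(* Both rates arise by replacing [WK] with a smaller positive [c]. *)
have weaken c : 0 < c -> c <= WK ->
    f xbar - f xs <= 4 * norm2 (x0 - xs) ^+ 2 / (F * c).
  move=> c0 cW; apply: (le_trans main); rewrite ler_wpM2l ?(mulr_ge0 (ler0n _ 4)) ?sqr_ge0 //.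
  by rewrite lef_pV2 ?posrE ?(mulr_gt0 F0) // ler_wpM2l ?(ltW F0).
split=> // [_|mu0 K1].
  have -> : (1 - mu * F / 2) ^+ K * (4 * norm2 (x0 - xs) ^+ 2 / F)
      = 4 * norm2 (x0 - xs) ^+ 2 / (F * (1 - mu * F / 2) ^- K).
    by rewrite [in RHS]invfM invrK [LHS]mulrC !mulrA.
  by apply: weaken; rewrite ?invr_gt0 ?exprn_gt0.
apply: weaken; first by rewrite ltr0n.
(* For [mu = 0] all weights are 1, so [WK] is [K.+1]. *)
rewrite /WK /weight_sum /weight mu0 !mul0r subr0.
under eq_bigr => k _ do rewrite expr1n invr1.
by rewrite sumr_const card_ord ler_nat.
Qed.
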